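(* Let $\mu$ be a symmetric vector valued form of degree $1$ on a graded vector space $E=\oplus_{i\in\mathbb Z}E_i$. The Euler map $S:E\to E$, $S(X)=-|X|X$ for homogeneous $X$, is a Nijenhuis vector valued form with respect to $\mu$ with square $S$.
   Context: Base field $\mathbb K=\mathbb R$ or $\mathbb C$; $|X|$ is the degree of a homogeneous $X\in E$. A symmetric vector valued $k$-form ($k\ge 0$) is a graded symmetric $k$-linear map $K:E\times\cdots\times E\to E$ (for $k=0$, an element of $E$). It has degree $\bar K$ if $|K(X_1,\dots,X_k)|=|X_1|+\cdots+|X_k|+\bar K$ (for $X\in E$, $\bar X=|X|$). A symmetric vector valued form is a formal sum $\sum_{k\ge0}K_k$ of vector valued $k$-forms; it has degree $d$ if all $K_k$ do. Insertion: for a $k$-form $K$ and an $l$-form $L$ with $l\ge1$, $$\iota_KL(X_1,\dots,X_{k+l-1})=\sum_{\sigma\in Sh(k,l-1)}\epsilon(\sigma)L(K(X_{\sigma(1)},\dots,X_{\sigma(k)}),X_{\sigma(k+1)},\dots,X_{\sigma(k+l-1)}),$$ where $Sh(k,l-1)$ is the set of $(k,l-1)$-unshuffles and $\epsilon(\sigma)$ is the Koszul sign ($X_{\sigma(1)}\cdots X_{\sigma(n)}=\epsilon(\sigma)X_1\cdots X_n$ in the graded symmetric algebra); $\iota_KL=0$ if $L\in E$; and $\iota_XK=K(X,\cdot,\dots,\cdot)$ for $X\in E$. Richardson-Nijenhuis bracket: $[K,L]_{_{RN}}=\iota_KL-(-1)^{\bar K\bar L}\iota_LK$, extended to formal sums.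 For a symmetric vector valued form $\mu$ of degree $1$, a form $\mathcal N$ of degree zero is Nijenhuis with respect to $\mu$ with square $\mathcal K$ if $\mathcal K$ is a vector valued form of degree zero with $[\mathcal N,[\mathcal N,\mu]_{_{RN}}]_{_{RN}}=[\mathcal K,\mu]_{_{RN}}$ and $[\mathcal N,\mathcal K]_{_{RN}}=0$. *)

(* Defs.v *)
From HB Require Import structures.
From mathcomp Require Import all_boot all_order all_fingroup all_algebra.
From mathcomp Require Import boolp classical_sets functions cardinality fsbigop.
From mathcomp Require Import reals complex.

Set Implicit Arguments.
Unset Strict Implicit.
Unset Printing Implicit Defensive.

Import GRing.Theory.
Local Open Scope classical_set_scope.
Local Open Scope ring_scope.

Inductive ground := Reals | Complexes.

Definition ground_field (R : realType) (g : ground) : fieldType :=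
  match g with Reals => R | Complexes => R[i] end.

Section DirectSum.
Variables (K : fieldType) (E : int -> lmodType K).

(* The graded vector space \oplus_(i : int) E i, as finitely supported
   families. *)
Record dsum := DSum {
  coord :> forall i, E i ;
  coordP : `[< finite_set [set i | coord i != 0] >] }.

HB.instance Definition _ := [isSub for coord].
HB.instance Definition _ := [Choice of dsum by <:].

Lemma dsum_eqP (x y : dsum) : (forall i, x i = y i) <-> x = y.
Proof.
split=> [xy|->//]; apply: val_inj; rewrite /=.
by apply: functional_extensionality_dep.
Qed.

Lemma dsum_finite (x : dsum) : finite_set [set i | x i != 0].
Proof. by have /asboolP := coordP x. Qed.

Lemma dsum_map_subproof (f : forall i, E i -> E i) (x : dsum) :
  (forall i, f i 0 = 0) ->
  `[< finite_set [set i | f i (x i) != 0] >].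
Proof.
move=> f0; apply/asboolP; apply: sub_finite_set (dsum_finite x) => i /=.
by apply: contra_neq => ->; apply: f0.
Qed.

Lemma dsum0_subproof : `[< finite_set [set i : int | (0 : E i) != 0] >].
Proof.
apply/asboolP; suff -> : [set i : int | (0 : E i) != 0] = set0 by exact: finite_set0.
by apply/seteqP; split=> i //=; rewrite eqxx.
Qed.

Lemma dsumD_subproof (x y : dsum) :
  `[< finite_set [set i | x i + y i != 0] >].
Proof.
apply/asboolP; have fxy : finite_set ([set i | x i != 0] `|` [set i | y i != 0]).
  by rewrite finite_setU; split; apply: dsum_finite.
apply: sub_finite_set fxy => i /= xy.
have [x0|] := eqVneq (x i) 0; last by left.
by right; move: xy; rewrite x0 add0r.
Qed.

Definition dsum0 := DSum dsum0_subproof.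
Definition dsumD x y := DSum (dsumD_subproof x y).
Definition dsumN (x : dsum) :=
  DSum (@dsum_map_subproof (fun i u => - u) x (fun i => oppr0 (E i))).
Definition dsumZ (a : K) (x : dsum) :=
  DSum (@dsum_map_subproof (fun i u => a *: u) x (fun i => scaler0 (E i) a)).

Lemma dsumDA : associative dsumD.
Proof. by move=> x y z; apply/dsum_eqP => i /=; rewrite addrA. Qed.
Lemma dsumDC : commutative dsumD.
Proof. by move=> x y; apply/dsum_eqP => i /=; rewrite addrC. Qed.
Lemma dsum0D : left_id dsum0 dsumD.
Proof. by move=> x; apply/dsum_eqP => i /=; rewrite add0r. Qed.
Lemma dsumND : left_inverse dsum0 dsumN dsumD.
Proof. by move=> x; apply/dsum_eqP => i /=; rewrite addNr. Qed.

HB.instance Definition _ :=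
  GRing.isZmodule.Build dsum dsumDA dsumDC dsum0D dsumND.

Lemma dsumZA a b x : dsumZ a (dsumZ b x) = dsumZ (a * b) x.
Proof. by apply/dsum_eqP => i /=; rewrite scalerA. Qed.
Lemma dsumZ1 : left_id 1 dsumZ.
Proof. by move=> x; apply/dsum_eqP => i /=; rewrite scale1r. Qed.
Lemma dsumZDr : right_distributive dsumZ +%R.
Proof. by move=> a x y; apply/dsum_eqP => i /=; rewrite scalerDr. Qed.
Lemma dsumZDl x : {morph dsumZ^~ x : a b / a + b}.
Proof. by move=> a b; apply/dsum_eqP => i /=; rewrite scalerDl. Qed.

HB.instance Definition _ :=
  GRing.Zmodule_isLmodule.Build K dsum dsumZA dsumZ1 dsumZDr dsumZDl.

Definition homogeneous (i : int) (x : dsum) : Prop :=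
  forall j, j != i -> x j = 0.

Definition hpart (i : int) (x : dsum) : dsum :=
  DSum (@dsum_map_subproof (fun j u => if j == i then u else 0) x
          (fun j => if_same (j == i) 0)).

Definition euler (x : dsum) : dsum :=
  DSum (@dsum_map_subproof (fun i u => - (i%:~R *: u)) x
          (fun i => etrans (congr1 _ (scaler0 _ _)) (oppr0 (E i)))).

Lemma hpart_homogeneous i x : homogeneous i (hpart i x).
Proof. by move=> j /negPf /= ->. Qed.

Lemma euler_homogeneous i x : homogeneous i x -> euler x = - (i%:~R *: x).
Proof.
move=> xi; apply/dsum_eqP => j; have [->//|ji] := eqVneq j i.
by rewrite /= xi // !scaler0.
Qed.

End DirectSum.

Section Koszul.
Variable K : fieldType.

(* X_(s 1) ... X_(s n) = koszul d s * X_1 ... X_n in the graded symmetric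
   algebra when |X_i| = d i (see koszulP below): one factor for each inversion
   of s. *)
Definition koszul n (d : 'I_n -> int) (s : 'S_n) : K :=
  \prod_(i < n) \prod_(j < n | (i < j)%N && (s j < s i)%N)
     (-1) ^ (d (s i) * d (s j)).

Fixpoint inversions n (d : 'I_n -> int) (t : seq 'I_n) : K :=
  if t is i :: t' then
    (\prod_(j <- t' | (j < i)%N) (-1) ^ (d i * d j)) * inversions d t'
  else 1.

Fixpoint insert_ord n (i : 'I_n) (t : seq 'I_n) : seq 'I_n :=
  if t is j :: t' then
    if (j < i)%N then j :: insert_ord i t' else i :: t
  else [:: i].

Lemma perm_insert_ord n (i : 'I_n) t : perm_eq (insert_ord i t) (i :: t).
Proof.
elim: t => //= j t IH; case: ifP => // _.
by rewrite (perm_trans (_ : perm_eq _ (j :: i :: t))) ?perm_cons // -cat1s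
  -(cat1s i) -[i :: j :: t]cat1s -(cat1s j t) perm_catCA.
Qed.

Local Notation ord_lt := (relpre (@nat_of_ord _) ltn).

Lemma path_insert_ord n (i j : 'I_n) t : (j < i)%N -> i \notin t ->
  path ord_lt j t -> path ord_lt j (insert_ord i t).
Proof.
elim: t j => [|l t IH] j /= ji; first by rewrite ji.
rewrite inE negb_or => /andP[il it] /andP[jl lt].
case: ltnP => li /=; first by rewrite jl IH.
by rewrite ji lt ltn_neqAle li (inj_eq val_inj) il.
Qed.

Lemma sorted_insert_ord n (i : 'I_n) t : i \notin t ->
  sorted ord_lt t -> sorted ord_lt (insert_ord i t).
Proof.
case: t => //= j t; rewrite inE negb_or => /andP[ij it] jt.
case: ltnP => ji; first exact: path_insert_ord.
by rewrite /= jt ltn_neqAle ji (inj_eq val_inj) ij.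
Qed.

Section KoszulProduct.
Variables (A : algType K) (n : nat) (d : 'I_n -> int) (a : 'I_n -> A).
Hypothesis a_comm : forall i j, i != j ->
  a i * a j = (-1) ^ (d i * d j) *: (a j * a i).

Lemma prod_insert_ord i t : i \notin t -> sorted ord_lt t ->
  a i * \prod_(j <- t) a j =
  (\prod_(j <- t | (j < i)%N) (-1) ^ (d i * d j)) *:
    \prod_(j <- insert_ord i t) a j.
Proof.
elim: t => [|j t IH] /=; first by rewrite !big_nil big_seq1 mulr1 scale1r.
rewrite inE negb_or => /andP[ij it] jt; rewrite 2!big_cons.
case: ltnP => ji.
  rewrite mulrA a_comm // big_cons -scalerAl -mulrA IH ?(path_sorted jt) //.
  by rewrite -scalerAr scalerA.
rewrite !big_cons [X in X *: _]big_seq_cond [X in X *: _]big1 ?scale1r // => l /andP[lt li].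
have /allP/(_ l lt)/= jl : all (ord_lt j) t.
  by apply: order_path_min jt => x y z; apply: ltn_trans.
by have := leq_ltn_trans ji (ltn_trans jl li); rewrite ltnn.
Qed.

Lemma prod_inversions t : uniq t -> exists u, [/\ perm_eq u t,
  sorted ord_lt u &
  \prod_(j <- t) a j = inversions d t *: \prod_(j <- u) a j].
Proof.
elim: t => [_|i t IH /= /andP[it /IH[u [ut su eq_u]]]].
  by exists [::]; rewrite !big_nil scale1r.
have iu : i \notin u by rewrite (perm_mem ut).
exists (insert_ord i u); split.
- by rewrite (perm_trans (perm_insert_ord i u)) // perm_cons.
- exact: sorted_insert_ord.
- by rewrite big_cons eq_u -scalerAr prod_insert_ord // scalerA mulrC
    (perm_big _ ut).
Qed.

Lemma koszul_inversions (s : 'S_n) :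
  koszul d s = inversions d [seq s i | i <- enum 'I_n].
Proof.
have lt_trans : transitive (ord_lt : rel 'I_n).
  by move=> x y z; apply: ltn_trans.
have -> : koszul d s = \prod_(i <- enum 'I_n)
    \prod_(j <- enum 'I_n | (i < j)%N && (s j < s i)%N)
      (-1) ^ (d (s i) * d (s j)).
  by rewrite big_enum; apply: eq_bigr => i _; rewrite big_enum_cond.
have : sorted ord_lt (enum 'I_n).
  by rewrite -sorted_map val_enum_ord iota_ltn_sorted.
elim: (enum 'I_n) => [|i r IH] /=; first by rewrite big_nil.
move=> ir; rewrite -(IH (path_sorted ir)) big_cons; congr (_ * _).
  rewrite big_cons ltnn /= big_map big_seq_cond [RHS]big_seq_cond.
  apply: eq_bigl => j; case: (boolP (j \in r)) => //= jr.
  by have /allP/(_ j jr)/= -> := order_path_min lt_trans ir.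
apply: eq_big_seq => j jr; rewrite big_cons.
have /allP/(_ j jr)/= ij := order_path_min lt_trans ir.
by rewrite [(j < i)%N]ltnNge (ltnW ij).
Qed.

Lemma koszulP (s : 'S_n) :
  \prod_i a (s i) = koszul d s *: \prod_i a i.
Proof.
have lt_trans : transitive (ord_lt : rel 'I_n).
  by move=> x y z; apply: ltn_trans.
have big_enumE (f : 'I_n -> A) : \prod_i f i = \prod_(i <- enum 'I_n) f i.
  by rewrite enumT.
rewrite koszul_inversions !big_enumE -(big_map s xpredT a).
have [|u [us su ->]] := @prod_inversions [seq s i | i <- enum 'I_n].
  by rewrite map_inj_uniq ?enum_uniq //; apply: perm_inj.
have -> // : u = enum 'I_n.
apply: (sorted_eq lt_trans) su _ _.
- by move=> x y /andP[/ltnW xy /ltnW yx]; apply/val_inj/anti_leq/andP.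
- by rewrite -sorted_map val_enum_ord iota_ltn_sorted.
- apply: uniq_perm; rewrite ?(perm_uniq us) ?enum_uniq //.
    by rewrite map_inj_uniq ?enum_uniq //; apply: perm_inj.
  move=> x; rewrite (perm_mem us) mem_enum; apply/mapP.
  by exists (s^-1%g x); rewrite ?mem_enum ?permKV.
Qed.

End KoszulProduct.

End Koszul.

Section Forms.
Variables (K : fieldType) (E : int -> lmodType K).
Local Notation V := (dsum E).

Definition replace k (x : {ffun 'I_k -> V}) (i : 'I_k) (v : V) :
    {ffun 'I_k -> V} := [ffun j => if j == i then v else x j].

Definition multilinear k (F : {ffun 'I_k -> V} -> V) : Prop :=
  forall i x a u v, F (replace x i (a *: u + v)) =
                    a *: F (replace x i u) + F (replace x i v).

Definition graded_symmetric k (F : {ffun 'I_k -> V} -> V) : Prop :=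
  forall (d : 'I_k -> int) (x : {ffun 'I_k -> V}), (forall i, homogeneous (d i) (x i)) ->
  forall s : 'S_k, F [ffun i => x (s i)] = koszul K d s *: F x.

Definition has_degree k (D : int) (F : {ffun 'I_k -> V} -> V) : Prop :=
  forall (d : 'I_k -> int) (x : {ffun 'I_k -> V}), (forall i, homogeneous (d i) (x i)) ->
  homogeneous (\sum_i d i + D) (F x).

(* The formal sum of its components F k, k >= 0; a 0-form amounts to an
   element of V. *)
Definition formal_sum := forall k, {ffun 'I_k -> V} -> V.

Definition sym_vector_form (D : int) (F : formal_sum) : Prop :=
  forall k, [/\ multilinear (@F k), graded_symmetric (@F k)
              & has_degree D (@F k)].

Definition unshuffle k l (s : 'S_(k + l)) : bool :=
  [forall i : 'I_k, forall j : 'I_k,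
     (i < j)%N ==> (s (lshift l i) < s (lshift l j))%N] &&
  [forall i : 'I_l, forall j : 'I_l,
     (i < j)%N ==> (s (rshift k i) < s (rshift k j))%N].

Definition cons_arg l (v : V) (x : {ffun 'I_l -> V}) : {ffun 'I_l.+1 -> V} :=
  [ffun i => if unlift ord0 i is Some j then x j else v].

Definition insertion_hom k l (F : {ffun 'I_k -> V} -> V)
    (G : {ffun 'I_l.+1 -> V} -> V) (d : 'I_(k + l) -> int)
    (x : {ffun 'I_(k + l) -> V}) : V :=
  \sum_(s : 'S_(k + l) | unshuffle s) koszul K d s *:
     G (cons_arg (F [ffun i => x (s (lshift l i))])
                 [ffun j => x (s (rshift k j))]).

(* insertion_hom is the insertion on arguments that are homogeneous of degrees
   d; here it is extended to all arguments by decomposing each of them into its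
   homogeneous parts. *)
Definition insertion k l (F : {ffun 'I_k -> V} -> V)
    (G : {ffun 'I_l.+1 -> V} -> V) (x : {ffun 'I_(k + l) -> V}) : V :=
  \sum_(d \in [set: {ffun 'I_(k + l) -> int}])
     insertion_hom F G d [ffun i => hpart (d i) (x i)].

(* The n-ary component collects the insertions of F k into G l with
   k + l - 1 = n and l >= 1, i.e. l = (n - k).+1; there is no term with l = 0,
   as the insertion into a 0-form vanishes. *)
Definition formal_insertion (F G : formal_sum) : formal_sum := fun n x =>
  \sum_(k < n.+1) insertion (@F k) (@G (n - k).+1)
     [ffun i => x (cast_ord (subnKC (leq_ord k)) i)].

(* The Richardson-Nijenhuis bracket of forms F and G of degrees D and D'. *)
Definition rn_bracket (D D' : int) (F G : formal_sum) : formal_sum :=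
  fun n x => formal_insertion F G x - (-1) ^ (D * D') *: formal_insertion G F x.

Definition nijenhuis (mu N Q : formal_sum) : Prop :=
  [/\ sym_vector_form 0 N, sym_vector_form 0 Q,
      forall n (x : {ffun 'I_n -> V}),
        rn_bracket 0 (0 + 1) N (rn_bracket 0 1 N mu) x = rn_bracket 0 1 Q mu x
    & forall n (x : {ffun 'I_n -> V}), rn_bracket 0 0 N Q x = 0].

Definition euler_form : formal_sum := fun k =>
  match k with
  | 1%N => fun x => euler (x ord0)
  | _ => fun _ => 0
  end.

End Forms.

Arguments euler_form {K} E.

(* Main.v *)
(* For homogeneous X_1, ..., X_n and a form F of degree D, each (1, n-1)-unshuffle
   is determined by the argument X_i that it brings to the front, so inserting S
   into F multiplies F(X_1, ..., X_n) by -(|X_1| + ... + |X_n|), while inserting F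
   into S multiplies it by -(|X_1| + ... + |X_n| + D). Hence [S, F] = D F. With
   D = 1 this gives [S, [S, mu]] = mu = [S, mu], and with D = 0, [S, S] = 0. *)

Require Import Defs.
From mathcomp Require Import all_boot all_fingroup all_algebra reals.
From mathcomp Require Import boolp classical_sets cardinality fsbigop.
Set Implicit Arguments.
Unset Strict Implicit.
Unset Printing Implicit Defensive.
Import GRing.Theory.
Local Open Scope ring_scope.

(** * Multilinear maps and the decomposition of their arguments into homogeneous parts *)

Section Multilinear.
Variables (K : fieldType) (E : int -> lmodType K).
Local Notation V := (dsum E).

Definition hparts k (d : 'I_k -> int) (x : {ffun 'I_k -> V}) : {ffun 'I_k -> V} :=
  [ffun i => hpart (d i) (x i)].

Lemma hparts_homogeneous k (d : 'I_k -> int) (x : {ffun 'I_k -> V}) i :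
  homogeneous (d i) (hparts d x i).
Proof. by rewrite ffunE; apply: hpart_homogeneous. Qed.

Lemma replace_id k (x : {ffun 'I_k -> V}) i : replace x i (x i) = x.
Proof. by apply/ffunP => j; rewrite ffunE; case: eqP => [->|]. Qed.

Lemma cons_arg_eta k (x : {ffun 'I_k.+1 -> V}) :
  cons_arg (x ord0) [ffun j => x (lift ord0 j)] = x.
Proof. by apply/ffunP => i; rewrite ffunE; case: unliftP => [j|] ->; rewrite ?ffunE. Qed.

Lemma replace_cons_arg0 k v (x : {ffun 'I_k -> V}) u :
  replace (cons_arg v x) ord0 u = cons_arg u x.
Proof.
apply/ffunP => i; rewrite !ffunE; case: unliftP => [j|] ->; last by rewrite eqxx.
by rewrite eq_sym (negPf (neq_lift _ _)).
Qed.

Lemma replace_cons_argS k v (x : {ffun 'I_k -> V}) i u :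
  replace (cons_arg v x) (lift ord0 i) u = cons_arg v (replace x i u).
Proof.
apply/ffunP => l; rewrite !ffunE; case: unliftP => [j|] ->.
  by rewrite (inj_eq lift_inj) ffunE.
by rewrite (negPf (neq_lift _ _)).
Qed.

Section Maps.
Variables (k : nat) (F : {ffun 'I_k -> V} -> V).
Hypothesis linF : multilinear F.

Lemma multilinear0 (x : {ffun 'I_k -> V}) i : x i = 0 -> F x = 0.
Proof.
move=> xi; have rx : replace x i 0 = x by rewrite -xi replace_id.
have := linF i x 1 0 0; rewrite !scale1r addr0 rx => /eqP.
by rewrite -subr_eq0 opprD addNKr oppr_eq0 => /eqP.
Qed.

Lemma multilinearD (x : {ffun 'I_k -> V}) i u v :
  F (replace x i (u + v)) = F (replace x i u) + F (replace x i v).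
Proof. by rewrite -[u]scale1r linF !scale1r. Qed.

Lemma multilinear_replace0 (x : {ffun 'I_k -> V}) i : F (replace x i 0) = 0.
Proof. by apply: (@multilinear0 _ i); rewrite ffunE eqxx. Qed.

Lemma multilinearZ (x : {ffun 'I_k -> V}) i a u :
  F (replace x i (a *: u)) = a *: F (replace x i u).
Proof. by rewrite -[a *: u]addr0 linF multilinear_replace0 addr0. Qed.

Lemma multilinear_sumr (J : finType) (x : {ffun 'I_k -> V}) i (u : J -> V) :
  F (replace x i (\sum_j u j)) = \sum_j F (replace x i (u j)).
Proof.
exact: (big_morph (fun w => F (replace x i w)) (multilinearD x i)
                  (multilinear_replace0 x i)).
Qed.

End Maps.

Lemma multilinear_cons_arg k (F : {ffun 'I_k.+1 -> V} -> V) v :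
  multilinear F -> multilinear (F \o cons_arg v).
Proof. by move=> linF i x a u w; rewrite /= -!replace_cons_argS linF. Qed.

(** Induction on [k]: the sum in argument [ord0] is expanded first, then the remaining arguments,
    with that one held fixed by [cons_arg]. *)
Lemma multilinear_sum (J : finType) k (F : {ffun 'I_k -> V} -> V)
    (v : 'I_k -> J -> V) : multilinear F ->
  F [ffun i => \sum_j v i j] =
  \sum_(h : {ffun 'I_k -> J}) F [ffun i => v i (h i)].
Proof.
elim: k F v => [|k IH] F v linF.
  rewrite (eq_bigr (fun=> F [ffun i => \sum_j v i j])).
    by rewrite sumr_const card_ffun card_ord expn0.
  by move=> h _; congr F; apply/ffunP => -[].
(* The bijection from [J * J^k] to [J^(k.+1)] separates the index chosen for argument [ord0] from
   the others. *)
pose hcons (p : J * {ffun 'I_k -> J}) : {ffun 'I_k.+1 -> J} :=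
  [ffun i => if unlift ord0 i is Some j then p.2 j else p.1].
rewrite (reindex hcons) /=; last first.
  exists (fun h => (h ord0, [ffun j => h (lift ord0 j)])) => [[j h] _|h _].
    rewrite /hcons ffunE unlift_none; congr (_, _).
    by apply/ffunP => i; rewrite !ffunE liftK.
  by apply/ffunP => i; rewrite ffunE; case: unliftP => [j|] -> //=; rewrite ffunE.
rewrite -(pair_bigA _ (fun j h => F [ffun i => v i (hcons (j, h) i)])) /=.
rewrite -[X in F X]cons_arg_eta -(replace_cons_arg0 0) ffunE multilinear_sumr //.
apply: eq_bigr => j _; rewrite replace_cons_arg0.
rewrite (_ : finfun _ = [ffun i => \sum_j v (lift ord0 i) j]); last first.
  by apply/ffunP => i; rewrite !ffunE.
have /= -> := IH _ (fun i => v (lift ord0 i)) (multilinear_cons_arg (v ord0 j) linF).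
apply: eq_bigr => h _ /=; congr F; apply/ffunP => i; rewrite !ffunE.
by case: unliftP => [l|] ->; rewrite ?ffunE.
Qed.

Lemma coord_sum (I : Type) (r : seq I) (f : I -> V) t :
  (\sum_(j <- r) f j) t = \sum_(j <- r) f j t.
Proof. by elim/big_rec2: _ => [//|j u v _ <-]. Qed.

(** Degrees in [s] outside the support contribute zero, and [seq_sub s] counts a repeated degree
    only once. *)
Lemma sum_hpart (s : seq int) (x : V) : (forall t, x t != 0 -> t \in s) ->
  \sum_(j : seq_sub s) hpart (val j) x = x.
Proof.
move=> xs; apply/dsum_eqP => t; rewrite coord_sum.
have [ts|/negP ts] := boolP (t \in s).
  rewrite (bigD1 (SeqSub ts)) //= eqxx big1 ?addr0 // => j jt.
  by rewrite ifN //; apply: contraNneq jt => tj; apply/eqP/val_inj.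
rewrite big1 => [|j _]; first by apply/esym/eqP; apply: contra_notT ts => /xs.
by rewrite /= ifN //; apply/eqP => tj; apply: ts; rewrite tj; apply: valP.
Qed.

(** [insertion] is a sum over all degree assignments [d]; writing a multilinear map as such a sum
    lets the two be compared term by term, on homogeneous arguments. *)
Lemma sum_hparts k (F : {ffun 'I_k -> V} -> V) (x : {ffun 'I_k -> V}) :
  multilinear F ->
  \sum_(d \in [set: {ffun 'I_k -> int}]) F (hparts d x) = F x.
Proof.
move=> linF.
have /choice[s xs] i : exists s : seq int, forall t, x i t != 0 -> t \in s.
  have /finite_seqP[s /seteqP[xs _]] := dsum_finite (x i).
  by exists s.
(* A single list covers the supports of all arguments, so the assignments with values in it form a
   finite type. *)
pose S := flatten [seq s i | i : 'I_k].
have xS i t : x i t != 0 -> t \in S.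
  move=> /xs ts; apply/flattenP; exists (s i) => //.
  by apply: map_f; rewrite mem_enum.
pose g (h : {ffun 'I_k -> seq_sub S}) : {ffun 'I_k -> int} := [ffun i => val (h i)].
have g_inj : injective g.
  by move=> h h' /ffunP hh'; apply/ffunP => i; have := hh' i; rewrite !ffunE => /val_inj.
rewrite -(@fsbig_widen _ _ _ _ [set` codom g]) //=; last first.
  (* If some [d i] lies outside [S], then [hpart (d i) (x i)] is zero and the term vanishes. *)
  move=> d [_ /= dg]; have [/forallP dS|] := boolP [forall i, d i \in S].
    case: dg; apply/codomP; exists [ffun i => SeqSub (dS i)].
    by apply/ffunP => i; rewrite !ffunE.
  rewrite negb_forall => /existsP[i di]; apply: (@multilinear0 _ _ linF _ i).
  rewrite ffunE; apply/dsum_eqP => t /=; case: eqP => // ->.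
  by apply/eqP; apply: contraNT di => /xS.
rewrite -fsbig_seq; last by rewrite map_inj_uniq ?enum_uniq.
rewrite big_map big_enum /=.
rewrite (eq_bigr (fun h : {ffun 'I_k -> seq_sub S} =>
   F [ffun i => hpart (val (h i)) (x i)])); last first.
  by move=> h _; congr F; apply/ffunP => i; rewrite !ffunE.
rewrite -(multilinear_sum (fun i (j : seq_sub S) => hpart (val j) (x i))) //.
by congr F; apply/ffunP => i; rewrite ffunE sum_hpart // => t; apply: xS.
Qed.

End Multilinear.

(** * Koszul signs and the unshuffles of types (k, 0) and (1, l) *)

Lemma koszul_sqr (K : fieldType) n (d : 'I_n -> int) (s : 'S_n) :
  koszul K d s * koszul K d s = 1.
Proof.
rewrite -big_split big1 // => i _; rewrite -big_split big1 // => j _.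
by rewrite /= -exprMz_comm ?mulrNN ?mulr1 ?exp1rz //; apply: unitrN1.
Qed.

Lemma koszul1 (K : fieldType) n (d : 'I_n -> int) : koszul K d 1 = 1.
Proof.
rewrite /koszul big1 // => i _; rewrite big1 // => j.
by rewrite !perm1 => /andP[ij /(ltn_trans ij)]; rewrite ltnn.
Qed.

(** A finite set of ordinals has only one strictly increasing enumeration. Hence each block of an
    unshuffle is determined by its image. *)
Lemma increasing_inj_eq k n (f g : 'I_k -> 'I_n) :
  {homo f : i j / (i < j)%N} -> {homo g : i j / (i < j)%N} ->
  codom f =i codom g -> f =1 g.
Proof.
move=> f_inc g_inc fg i.
pose ord_lt m := relpre (@nat_of_ord m) ltn.
have lt_trans : transitive (ord_lt n) by move=> x y z; apply: ltn_trans.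
have enum_sorted : sorted (ord_lt k) (enum 'I_k).
  by rewrite -sorted_map val_enum_ord iota_ltn_sorted.
have srt (h : 'I_k -> 'I_n) : {homo h : i j / (i < j)%N} -> sorted (ord_lt n) (codom h).
  by move=> h_inc; apply: homo_sorted enum_sorted.
have /eq_in_map := irr_sorted_eq lt_trans (fun j => ltnn j) (srt _ f_inc) (srt _ g_inc) fg.
by apply; rewrite mem_enum.
Qed.

Lemma unshuffleP k l (s : 'S_(k + l)) : reflect
  ({homo (fun i => s (lshift l i)) : i j / (i < j)%N} /\
   {homo (fun i => s (rshift k i)) : i j / (i < j)%N}) (unshuffle s).
Proof.
apply: (iffP andP) => -[H1 H2]; split.
- by move=> i j; apply/implyP; move: H1 => /forallP/(_ i)/forallP/(_ j).
- by move=> i j; apply/implyP; move: H2 => /forallP/(_ i)/forallP/(_ j).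
- by apply/forallP => i; apply/forallP => j; apply/implyP/H1.
- by apply/forallP => i; apply/forallP => j; apply/implyP/H2.
Qed.

(** The first block is everything, so [s] and the identity are both increasing enumerations of
    ['I_(k + 0)]. *)
Lemma unshuffle_k0 k (s : 'S_(k + 0)) : unshuffle s = (s == 1%g).
Proof.
apply/unshuffleP/eqP => [[s_inc _]|->]; last first.
  by split=> [i j|[]//]; rewrite !perm1.
have surj (t : 'S_(k + 0)) (j : 'I_(k + 0)) : j \in codom (fun i => t (lshift 0 i)).
  have lt_k : (t^-1%g j < k)%N by rewrite -[X in (_ < X)%N]addn0.
  apply/codomP; exists (Ordinal lt_k); rewrite -[LHS](permKV t); congr (t _).
  exact/val_inj.
have one_inc : {homo (fun i => (1%g : 'S_(k + 0)) (lshift 0 i)) : i j / (i < j)%N}.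
  by move=> i j; rewrite !perm1.
have eq1 := increasing_inj_eq s_inc one_inc (fun j => etrans (surj s j) (esym (surj 1%g j))).
apply/permP => i; have lt_k : (i < k)%N by rewrite -[X in (_ < X)%N]addn0.
have -> : i = lshift 0 (Ordinal lt_k) by apply/val_inj.
exact: eq1.
Qed.

Lemma rshift1 l (j : 'I_l) : rshift 1 j = lift ord0 j.
Proof. exact/val_inj. Qed.

Lemma lshift1 l (i : 'I_1) : lshift l i = ord0.
Proof. by apply/val_inj; rewrite (ord1 i). Qed.

(** [lift_perm ord0 i 1] sends [ord0] to [i] and the other indices, in order, to the complement of
    [i]. For [i = s ord0], the second block of an unshuffle [s] is increasing with the same
    image. *)
Lemma unshuffle_1l l (s : 'S_(1 + l)) :
  unshuffle s = (lift_perm ord0 (s ord0) 1 == s :> 'S_l.+1).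
Proof.
have lift_inc (i : 'I_l.+1) : {homo lift i : j j' / (j < j')%N}.
  by move=> j j'; rewrite /= (ltnNge (bump i j)) leq_bump2 -ltnNge.
apply/unshuffleP/eqP => [[_ s_inc]|<-]; last first.
  split=> [i j|i j ij]; first by rewrite !ord1 ltnn.
  by rewrite !rshift1 !lift_perm_lift !perm1 lift_inc.
apply/permP => i; case: (unliftP ord0 i) => [j|] ->; last by rewrite lift_perm_id.
rewrite lift_perm_lift perm1 -rshift1; apply/esym.
apply: (increasing_inj_eq s_inc (lift_inc _)) => {}i; apply/codomP/codomP => -[t ->].
  case: (unliftP (s ord0) (s (rshift 1 t))) => [u|/perm_inj]; first by exists u.
  by rewrite rshift1 => /eqP; rewrite eq_sym (negPf (neq_lift _ _)).
have := permKV s (lift (s ord0) t).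
case: (unliftP ord0 (s^-1%g (lift (s ord0) t))) => [u ->|-> /eqP].
  by exists u; rewrite rshift1.
by rewrite (negPf (neq_lift _ _)).
Qed.

Lemma sum_unshuffle_1l (V : nmodType) l (f : 'I_(1 + l) -> V) :
  \sum_(s : 'S_(1 + l) | unshuffle s) f (s ord0) = \sum_i f i.
Proof.
rewrite (reindex_onto (fun i => lift_perm ord0 i 1 : 'S_(1 + l)) (fun s => s ord0)).
  by apply: eq_big => i; rewrite ?unshuffle_1l lift_perm_id ?eqxx.
by move=> s; rewrite unshuffle_1l => /eqP.
Qed.

(** * Insertions of and into the Euler map, and its bracket with a form *)

Section Euler.
Variables (K : fieldType) (E : int -> lmodType K).
Local Notation V := (dsum E).

Lemma eulerP a (u v : V) : euler (a *: u + v) = a *: euler u + euler v.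
Proof.
apply/dsum_eqP => i; rewrite /= scalerDr opprD; congr (_ + _).
by rewrite scalerN !scalerA mulrC.
Qed.

Lemma multilinear_euler k (F : {ffun 'I_k -> V} -> V) D : multilinear F ->
  multilinear (fun x => euler (F x) + D *: F x).
Proof.
move=> linF i x a u v; rewrite /= linF eulerP !scalerDr addrACA !scalerA.
by rewrite (mulrC D).
Qed.

Lemma multilinear_lshift0 k (F : {ffun 'I_k -> V} -> V) : multilinear F ->
  multilinear (fun x : {ffun 'I_(k + 0) -> V} => F [ffun i => x (lshift 0 i)]).
Proof.
move=> linF i x a u v; have lt_k : (i < k)%N by rewrite -[X in (_ < X)%N]addn0.
have repl w : [ffun j => replace x i w (lshift 0 j)] =
    replace [ffun j => x (lshift 0 j)] (Ordinal lt_k) w.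
  by apply/ffunP => j; rewrite !ffunE.
by rewrite !repl.
Qed.

(** The value of [F] is the first argument of [G], which vanishes there by linearity. *)
Lemma insertion_hom_0l k l (F : {ffun 'I_k -> V} -> V)
    (G : {ffun 'I_l.+1 -> V} -> V) d x :
  F =1 (fun=> 0) -> multilinear G -> insertion_hom F G d x = 0.
Proof.
move=> F0 linG; apply: big1 => s _; rewrite F0.
by rewrite (multilinear0 linG (i := ord0)) ?scaler0 // ffunE unlift_none.
Qed.

Lemma insertion_0l k l (F : {ffun 'I_k -> V} -> V)
    (G : {ffun 'I_l.+1 -> V} -> V) x :
  F =1 (fun=> 0) -> multilinear G -> insertion F G x = 0.
Proof. by move=> F0 linG; apply: fsbig1 => d _; apply: insertion_hom_0l. Qed.

Lemma insertion_0r k l (F : {ffun 'I_k -> V} -> V)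
    (G : {ffun 'I_l.+1 -> V} -> V) x :
  G =1 (fun=> 0) -> insertion F G x = 0.
Proof.
move=> G0; apply: fsbig1 => d _; apply: big1 => s _.
by rewrite G0 scaler0.
Qed.

(** On [F x], of degree [\sum_i d i + D], the Euler map is minus that degree; the added term cancels
    the share of [D]. *)
Lemma euler_has_degree D k (F : {ffun 'I_k -> V} -> V) (d : 'I_k -> int)
    (x : {ffun 'I_k -> V}) :
  has_degree D F -> (forall i, homogeneous (d i) (x i)) ->
  euler (F x) + D%:~R *: F x = - ((\sum_i d i)%:~R *: F x).
Proof.
move=> degF /degF/euler_homogeneous ->.
by rewrite rmorphD /= scalerDl opprD subrK.
Qed.

Lemma insertion_eulerr k (F : {ffun 'I_k -> V} -> V) (x : {ffun 'I_(k + 0) -> V}) :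
  multilinear F ->
  insertion F (@euler_form K E 1) x = euler (F [ffun i => x (lshift 0 i)]).
Proof.
move=> linF; pose G (y : {ffun 'I_(k + 0) -> V}) := euler (F [ffun i => y (lshift 0 i)]).
have linG : multilinear G.
  by move=> i y a u v; rewrite /G (multilinear_lshift0 linF) eulerP.
rewrite -[RHS](sum_hparts x linG); apply: eq_fsbigr => d _.
rewrite /insertion_hom (big_pred1 1%g) => [|s]; last exact: unshuffle_k0.
rewrite koszul1 scale1r /= ffunE unlift_none /G; congr (euler (F _)).
by apply/ffunP => i; rewrite !ffunE perm1.
Qed.

(** The right-hand side avoids the degrees of the arguments, so it makes sense for inhomogeneous [x]
    and is multilinear, as [sum_hparts] requires. *)
Lemma insertion_eulerl D l (F : {ffun 'I_l.+1 -> V} -> V)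
    (x : {ffun 'I_(1 + l) -> V}) :
  multilinear F -> graded_symmetric F -> has_degree D F ->
  insertion (@euler_form K E 1) F x = euler (F x) + D%:~R *: F x.
Proof.
move=> linF symF degF.
rewrite -[RHS](sum_hparts x (multilinear_euler D%:~R linF)).
apply: eq_fsbigr => d _.
have hom_x i : homogeneous (d i) (hparts d x i) by apply: hparts_homogeneous.
rewrite (euler_has_degree degF hom_x) -/(hparts d x).
move: (hparts d x) hom_x => {}x hom_x.
(* The total degree is split into one summand for each index [i], matched with the unshuffle such
   that [s ord0 = i]. *)
rewrite /insertion_hom raddf_sum /= scaler_suml -sumrN.
rewrite -(sum_unshuffle_1l (fun i => - ((d i)%:~R *: F x))).
apply: eq_bigr => s _; rewrite ffunE lshift1.
rewrite (euler_homogeneous (hom_x _)) -scaleNr -(replace_cons_arg0 0).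
rewrite multilinearZ // replace_cons_arg0.
rewrite (_ : cons_arg _ _ = [ffun i => x (s i)]); last first.
  apply/ffunP => i; rewrite !ffunE; case: unliftP => [j|] -> //.
  by rewrite ffunE rshift1.
(* The Koszul sign of s occurs twice: in the insertion and by symmetry of F. *)
by rewrite (symF d) // !scalerA mulrAC koszul_sqr mul1r scaleNr.
Qed.

Lemma rn_bracket_euler D D' (F : formal_sum E) n x : sym_vector_form D F ->
  rn_bracket 0 D' (euler_form E) F x = D%:~R *: @F n x.
Proof.
move=> symF; rewrite /rn_bracket mul0r expr0z scale1r.
have -> : formal_insertion F (euler_form E) x = euler (F n x).
  (* Only [k = n] contributes: for [k < n] the Euler form is evaluated in arity [(n - k).+1 > 1],
     where it is zero. *)
  rewrite /formal_insertion (bigD1 ord_max) //= big1 ?addr0 => [|k]; last first.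
    rewrite -val_eqE /= => kn; apply: insertion_0r.
    have : (0 < n - k)%N by rewrite subn_gt0 ltn_neqAle kn -ltnS ltn_ord.
    by case: (n - k)%N.
  move: (subnKC _); rewrite subnn => e; rewrite insertion_eulerr.
    congr (euler (F n _)); apply/ffunP => i; rewrite !ffunE.
    by congr (x _); apply/val_inj.
  by case: (symF n).
have [linF sF dF] := symF n; case: n x linF sF dF => [|n] x linF sF dF.
  (* In arity 0 the insertion of the Euler form vanishes, and [F x] has degree [D], so
     [- euler (F x)] is already [D] times [F x]. *)
  rewrite /formal_insertion big_ord1 insertion_0l //; last by case: (symF 1%N).
  have /= := euler_has_degree dF (d := fun=> 0) (x := x).
  rewrite big_ord0 scale0r oppr0 sub0r => H; apply/eqP.
  by rewrite eq_sym -addr_eq0 addrC H // => -[].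
(* [lift ord0 ord0] is the index 1, the only arity in which the Euler form is nonzero. *)
rewrite /formal_insertion (bigD1 (lift ord0 ord0)) //= big1 ?addr0 => [|k k1]; last first.
  apply: insertion_0l; last by case: (symF (n.+1 - k).+1).
  by move: k1; rewrite -val_eqE /=; case: (val k) => [|[]].
move: (subnKC _); rewrite subSS subn0 => e; rewrite (insertion_eulerl _ linF sF dF).
rewrite (_ : [ffun _ => _] = x); first by rewrite addrAC subrr add0r.
by apply/ffunP => i; rewrite ffunE; congr (x _); apply/val_inj.
Qed.

Lemma euler_form_sym : sym_vector_form 0 (euler_form E).
Proof.
case=> [|[|k]]; (split=> [i x a u v|d x hom_x s|d x hom_x]) => //=;
  rewrite ?scaler0 ?addr0 //.
- by rewrite !ffunE !ord1 /= eulerP.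
- by rewrite [s]permS1 koszul1 scale1r ffunE perm1.
- by rewrite big_ord1 => j jd; rewrite /= hom_x // scaler0 oppr0.
Qed.

End Euler.

Theorem proposition2p7 (R : realType) (g : ground)
    (E : int -> lmodType (ground_field R g)) (mu : formal_sum E)
    (hmu : sym_vector_form 1 mu) :
  nijenhuis mu (euler_form E) (euler_form E).
Proof.
split=> [||n x|n x]; try exact: euler_form_sym.
  (* The equality holds between formal sums, in every arity at once, so that it can be applied
     inside the outer bracket. *)
  have -> : rn_bracket 0 1 (euler_form E) mu = mu.
    apply: functional_extensionality_dep => k.
    apply: functional_extensionality_dep => y.
    by rewrite (rn_bracket_euler _ _ hmu) scale1r.
  by rewrite (rn_bracket_euler _ _ hmu) scale1r.
by rewrite (rn_bracket_euler _ _ (euler_form_sym E)) scale0r.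
Qed.
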